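(* Let $(X_i,d_i,\mu_i)$, $i=1,\dots,n$, be spaces of homogeneous type, let $\Omega\subset\prod_{i=1}^nX_i$ be a measurable set, let $P=(p_1,\dots,p_n)$ with $1\le p_i<\infty$, and let $g$ be a measurable function on $\Omega$. Then the multiplication operator $$M_g:L_P(\Omega)\to L_P(\Omega),\qquad (M_gf)(x)=f(x)g(x),$$ is bounded if and only if $g\in L_\infty(\Omega)$. In this case the norm of the operator is $$\|M_g\|=\operatorname*{ess\,sup}_{x\in\Omega}|g(x)|.$$
   Context: Space of homogeneous type: a metric space $(X,d)$ with a Borel measure $\mu$ that is doubling, i.e. there is a constant $c$ with $0<\mu(B(x,2r))\le c\,\mu(B(x,r))<\infty$ for all $x\in X$, $r>0$. Mixed norm space: $L_P(\Omega)$ is the set of measurable functions $f$ (modulo a.e. equality) with finite norm $$\|f\|_{L_P(\Omega)}=\bigg(\int_{X_1}\bigg(\cdots\bigg(\int_{X_n}|f(x)|^{p_n}\chi_\Omega(x)\,d\mu_n\bigg)^{\frac{p_{n-1}}{p_n}}\cdots\bigg)^{\frac{p_1}{p_2}}d\mu_1\bigg)^{\frac1{p_1}}.$$ The operator $M_g$ is bounded if $fg\in L_P(\Omega)$ for all $f\in L_P(\Omega)$ and $\|fg\|_{L_P(\Omega)}\le K\|f\|_{L_P(\Omega)}$ with $K$ independent of $f$. $L_\infty(\Omega)$ and the essential supremum are with respect to $\mu_1\times\dots\times\mu_n$. *)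

(* Defs.v *)
From HB Require Import structures.
From mathcomp Require Import all_boot all_order all_algebra.
From mathcomp Require Import all_classical all_reals all_analysis.
From mathcomp Require Import ess_sup_inf.

Set Implicit Arguments.
Unset Strict Implicit.
Unset Printing Implicit Defensive.

Import Order.TTheory GRing.Theory Num.Theory.

Local Open Scope classical_set_scope.
Local Open Scope ring_scope.

(* [measurableType] inherits from [pointedType], so a metric space that carries
   its Borel sigma-algebra is nonempty. *)
#[short(type="pmetricType")]
HB.structure Definition PointedMetric (R : numDomainType) :=
  {T of Metric R T & Pointed T}.

Notation borel T := (g_sigma_algebraType (@open T)).

Record homogeneousSpace (R : realType) := HomogeneousSpace {
  hs_space : pmetricType R ;
  hs_measure : {measure set (borel hs_space) -> \bar R} ;
  hs_doubling : exists c : R, forall (x : hs_space) (r : R), 0 < r ->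
    [/\ (0 < hs_measure (ball x (2 * r)))%E,
        (hs_measure (ball x (2 * r)) <= c%:E * hs_measure (ball x r))%E &
        (c%:E * hs_measure (ball x r) < +oo)%E] }.

Section homogeneous_sigma_finite.
Variables (R : realType) (X : homogeneousSpace R).

Lemma measurable_metric_ball (x : hs_space X) (r : R) :
  measurable (ball x r : set (borel (hs_space X))).
Proof.
apply: sub_sigma_algebra; rewrite openE => y xry.
rewrite ballEmdist /= in xry.
apply/nbhs_ballP; exists (r - mdist x y) => /=; first by rewrite subr_gt0.
move=> z; rewrite !ballEmdist /= ltrBrDl => yz.
exact: le_lt_trans (metric_triangle x y z) yz.
Qed.

Lemma hs_sigma_finite : sigma_finite setT (hs_measure X).
Proof.
have [c dbl] := hs_doubling X.
exists (fun k => ball (point : hs_space X) (2 * k.+1%:R)).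
- apply/esym/seteqP; split => // y _.
  exists (Num.truncn (mdist point y)) => //=.
  rewrite ballEmdist /=; apply: lt_le_trans (truncnS_gt _) _.
  by rewrite ler_peMl// ler1n.
- move=> k; split; first exact: measurable_metric_ball.
  by have [//|_ h1 h2] := dbl point k.+1%:R; exact: le_lt_trans h1 h2.
Qed.

Definition hs_mu (A : set (borel (hs_space X))) : \bar R := hs_measure X A.

HB.instance Definition _ := Measure.copy hs_mu (hs_measure X).

HB.instance Definition _ :=
  Measure_isSigmaFinite.Build _ _ _ hs_mu hs_sigma_finite.

End homogeneous_sigma_finite.
Arguments hs_mu {R} X A.

Record sfMeasureSpace (R : realType) := SfMeasureSpace {
  sf_display : measure_display ;
  sf_carrier :> measurableType sf_display ;
  sf_measure : {sigma_finite_measure set sf_carrier -> \bar R} }.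

Definition sf_of_hs (R : realType) (X : homogeneousSpace R) :
    sfMeasureSpace R :=
  @SfMeasureSpace R _ (borel (hs_space X)) (hs_mu X).

(* The library's sigma-finite structure on [m1 \x m2] is shadowed by the one for
   finite measures, hence this copy. *)
Section sigma_finite_product.
Variables (R : realType) (S T : sfMeasureSpace R).
Local Notation ST := (sf_carrier S * sf_carrier T)%type.

Definition prod_measure (A : set ST) : \bar R :=
  (sf_measure S \x sf_measure T)%E A.

HB.instance Definition _ :=
  Measure.copy prod_measure (sf_measure S \x sf_measure T)%E.

Lemma prod_measure_sigma_finite : sigma_finite setT prod_measure.
Proof.
have /sigma_finiteP[F [TF ndF Foo]] := sigma_finiteT (sf_measure S).
have /sigma_finiteP[G [TG ndG Goo]] := sigma_finiteT (sf_measure T).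
exists (fun n => F n `*` G n).
- rewrite -setXTT TF TG predeqE => -[x y]; split.
  + move=> [/= [n _ Fnx] [k _ Gky]]; exists (maxn n k) => //; split.
      by move: x Fnx; exact/subsetPset/ndF/leq_maxl.
    by move: y Gky; exact/subsetPset/ndG/leq_maxr.
  + by move=> [n _ []/= ? ?]; split; exists n.
- move=> k; have [? ?] := Foo k; have [? ?] := Goo k.
  split; first exact: measurableX.
  by rewrite /prod_measure product_measure1E// lte_mul_pinfty// ge0_fin_numE.
Qed.

HB.instance Definition _ :=
  Measure_isSigmaFinite.Build _ _ _ prod_measure prod_measure_sigma_finite.

End sigma_finite_product.
Arguments prod_measure {R} S T A.

Definition sf_prod (R : realType) (S T : sfMeasureSpace R) :
    sfMeasureSpace R :=
  @SfMeasureSpace R _ (sf_carrier S * sf_carrier T)%type (prod_measure S T).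

(* X_1 * (X_2 * (... * X_n)), with the product sigma-algebra and the product
   measure; the number of factors is n.+1.  For homogeneous spaces, which are
   separable, the product sigma-algebra is the Borel sigma-algebra of the product
   topology. *)
Fixpoint prod_space (R : realType) (n : nat) :
    ('I_n.+1 -> sfMeasureSpace R) -> sfMeasureSpace R :=
  match n with
  | 0 => fun X => X ord0
  | m.+1 => fun X =>
      sf_prod (X ord0) (prod_space (fun i => X (lift ord0 i)))
  end.

(* The nested integral
     (int_{X_1} (... (int_{X_n} |f|^{p_n} chi_Omega)^{p_{n-1}/p_n} ...)
        ^{p_1/p_2})^{q/p_1}.
   The exponent q of the outermost power makes the definition recursive: the
   integral over the last n - 1 variables is raised to the power p_1/p_2. *)
Fixpoint mixed_integral (R : realType) (n : nat) (q : R) :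
    forall (X : 'I_n.+1 -> sfMeasureSpace R) (p : 'I_n.+1 -> R),
      set (prod_space X) -> (prod_space X -> R) -> \bar R :=
  match n with
  | 0 => fun X p Omega f =>
      (\int[sf_measure (X ord0)]_x
         (`|f x| `^ p ord0 * \1_Omega x)%:E) `^ (q / p ord0)
  | m.+1 => fun X p Omega f =>
      (\int[sf_measure (X ord0)]_x
         @mixed_integral R m (p ord0)
           (fun i => X (lift ord0 i)) (fun i => p (lift ord0 i))
           (xsection Omega x) (fun y => f (x, y))) `^ (q / p ord0)
  end%E.

Section mixed_norm_space.
Variables (R : realType) (n : nat).
Variables (X : 'I_n.+1 -> sfMeasureSpace R) (p : 'I_n.+1 -> R).
Variable Omega : set (prod_space X).

Definition mixed_norm (f : prod_space X -> R) : \bar R :=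
  mixed_integral 1 p Omega f.

(* Functions on Omega are represented by functions on the whole product, whose
   values outside Omega are irrelevant.  The elements of L_P(Omega) are the
   classes of such functions modulo equality a.e. on Omega; as [mixed_norm] is
   constant on each class, representatives are used instead of classes. *)
Definition L_mixed : set (prod_space X -> R) :=
  [set f | measurable_fun Omega f /\ (mixed_norm f < +oo)%E].

Definition bounded_operator
    (A : (prod_space X -> R) -> (prod_space X -> R)) : Prop :=
  exists K : R, forall f, L_mixed f ->
    L_mixed (A f) /\ (mixed_norm (A f) <= K%:E * mixed_norm f)%E.

Definition operator_norm
    (A : (prod_space X -> R) -> (prod_space X -> R)) : \bar R :=
  ereal_sup [set mixed_norm (A f) | f in
    [set f | L_mixed f /\ (mixed_norm f <= 1)%E]].

Definition mul_operator (g f : prod_space X -> R) : prod_space X -> R :=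
  fun x => f x * g x.

(* |g| is extended by 0 outside Omega, so that the essential supremum over a
   null set is 0 and not -oo. *)
Definition ess_sup_abs (g : prod_space X -> R) : \bar R :=
  ess_sup (sf_measure (prod_space X)) (fun x => (`|g x| * \1_Omega x)%:E).

Definition L_infty : set (prod_space X -> R) :=
  [set g | measurable_fun Omega g /\ (ess_sup_abs g < +oo)%E].

End mixed_norm_space.

(* Main.v *)
(* If |g| <= c a.e. on Omega, then |f g| <= c |f| a.e., and the mixed norm is
   homogeneous and monotone with respect to a.e. inequality.  Conversely, if
   ||f g|| <= c ||f|| for all f and |g| > c + e on a measurable E, then the
   indicators 1_(E n F_k), where the F_k exhaust the space and 1_(F_k) has finite
   mixed norm, satisfy (c + e) ||1_(E n F_k)|| <= c ||1_(E n F_k)||; hence their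
   norm vanishes and E is null. *)
Require Import Defs.
From mathcomp Require Import all_boot all_order all_algebra.
From mathcomp Require Import all_classical all_reals all_analysis.
From mathcomp Require Import ess_sup_inf measurable_realfun.

Set Implicit Arguments.
Unset Strict Implicit.
Unset Printing Implicit Defensive.

Import Order.TTheory GRing.Theory Num.Theory.

Local Open Scope classical_set_scope.
Local Open Scope ring_scope.

(** * Nested integrals: reduction to the whole product, and measurability in a parameter *)

Section mixed_integral_theory.
Variable R : realType.
Implicit Types (n : nat) (q : R).

Lemma measurable_norm_powR d (T : measurableType d) (h : T -> R) (r : R) :
  measurable_fun setT h ->
  measurable_fun setT (fun x => (`|h x| `^ r)%:E).
Proof.
move=> mh; apply/measurable_EFinP.
by apply: (measurableT_comp (measurable_powR _)); exact: measurableT_comp.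
Qed.

Lemma integral_norm_powR_indic (S : sfMeasureSpace R) (A : set S) (r : R) :
  measurable A -> 0 < r ->
  (\int[sf_measure S]_x (`|\1_A x : R| `^ r)%:E)%E = sf_measure S A.
Proof.
move=> mA r_gt0; rewrite -[in RHS](setIT A) -integral_indic//.
apply: eq_integral => x _; rewrite indicE.
case: (x \in A); first by rewrite normr1 powR1.
by rewrite normr0 powR0// gt_eqF.
Qed.

Lemma mixed_integral0 q (X : 'I_1 -> sfMeasureSpace R) (p : 'I_1 -> R)
    (h : prod_space X -> R) :
  mixed_integral q p setT h =
  ((\int[sf_measure (X ord0)]_x (`|h x| `^ p ord0)%:E) `^ (q / p ord0))%E.
Proof.
by rewrite /=; congr (_ `^ _)%E; apply: eq_integral => x _; rewrite indicT mulr1.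
Qed.

Lemma mixed_integralS n q (X : 'I_n.+2 -> sfMeasureSpace R) (p : 'I_n.+2 -> R)
    (h : prod_space X -> R) :
  mixed_integral q p setT h =
  ((\int[sf_measure (X ord0)]_x
      mixed_integral (p ord0) (fun i => p (lift ord0 i)) setT
        (fun y : prod_space (fun i => X (lift ord0 i)) => h (x, y)))
     `^ (q / p ord0))%E.
Proof.
rewrite /=; congr (_ `^ _)%E; apply: eq_integral => x _.
congr mixed_integral; apply/seteqP; split=> // y _ /=.
by rewrite /xsection /= inE.
Qed.

Lemma mixed_integral_ge0 n q (X : 'I_n.+1 -> sfMeasureSpace R)
    (p : 'I_n.+1 -> R) Omega (h : prod_space X -> R) :
  (0 <= mixed_integral q p Omega h)%E.
Proof. by case: n X p Omega h => [|n] X p Omega h; exact: poweR_ge0. Qed.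

(** Zero to a positive power is zero (to the power zero it would be one), so cutting [h] off outside
    [Omega] has the same effect as the factor [\1_Omega] in the innermost integral. The lemmas on
    nested integrals below can therefore be stated for [setT]. *)
Lemma mixed_integral_restrict n q (X : 'I_n.+1 -> sfMeasureSpace R)
    (p : 'I_n.+1 -> R) Omega (h : prod_space X -> R) :
  (forall i, 0 < p i) ->
  mixed_integral q p Omega h =
  mixed_integral q p setT (fun x => h x * \1_Omega x).
Proof.
elim: n q X p Omega h => [|n IH] q X p Omega h p_gt0.
  rewrite mixed_integral0; congr (_ `^ _)%E; apply: eq_integral => x _.
  rewrite indicE; case: (x \in Omega); rewrite !(mulr1, mulr0)// normr0.
  by rewrite powR0// gt_eqF.
rewrite mixed_integralS /=; congr (_ `^ _)%E; apply: eq_integral => x _.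
rewrite IH//; congr mixed_integral; apply/funext => y.
by rewrite !indicE mem_xsection.
Qed.

(** The free parameter space [T] carries the induction: the outermost variable joins the parameter,
    so the hypothesis is applied over [T * X ord0], and integrating that variable out preserves
    measurability by Fubini-Tonelli. *)
Lemma measurable_mixed_integral n q (X : 'I_n.+1 -> sfMeasureSpace R)
    (p : 'I_n.+1 -> R) d (T : measurableType d) (h : T * prod_space X -> R) :
  measurable_fun setT h ->
  measurable_fun setT
    ((fun t => mixed_integral q p setT (fun y => h (t, y))) : T -> \bar R).
Proof.
elim: n q X p d T h => [|n IH] q X p d T h mh.
  under eq_fun do rewrite mixed_integral0.
  apply: (measurableT_comp (measurable_poweR _)).
  apply: (measurable_fun_fubini_tonelli_F (fun z => (`|h z| `^ p ord0)%:E)).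
  - exact: measurable_norm_powR.
  - by move=> z; rewrite lee_fin powR_ge0.
under eq_fun do rewrite mixed_integralS.
apply: (measurableT_comp (measurable_poweR _)).
apply: (measurable_fun_fubini_tonelli_F
  (fun z : T * X ord0 => mixed_integral (p ord0) (fun i => p (lift ord0 i)) setT
        (fun y : prod_space (fun i => X (lift ord0 i)) => h (z.1, (z.2, y))))).
- apply: (IH _ _ _ _ _ (fun w => h (w.1.1, (w.1.2, w.2)))).
  apply: (measurableT_comp mh).
  repeat apply: measurable_fun_pair.
  - exact: (measurableT_comp measurable_fst measurable_fst).
  - exact: (measurableT_comp measurable_snd measurable_fst).
  - exact: measurable_snd.
- by move=> z; exact: mixed_integral_ge0.
Qed.

(** The product measure of [A] is the integral of the measures of its sections, and the integral of
    a nonnegative function vanishes exactly when the function does almost everywhere. The inductions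
    below use this to pass between null sets and their sections. *)
Lemma prod_measure_eq0 (S T : sfMeasureSpace R) (A : set (S * T)) :
  measurable A ->
  prod_measure S T A = 0%E <->
  {ae sf_measure S, forall x, sf_measure T (xsection A x) = 0%E}.
Proof.
move=> mA; have mxA := measurable_fun_xsection (sf_measure T) mA.
have -> : prod_measure S T A =
    (\int[sf_measure S]_x `|sf_measure T (xsection A x)|)%E.
  by apply: eq_integral => x _; rewrite gee0_abs.
apply: iff_trans (ae_eq_integral_abs (sf_measure S) measurableT mxA) _.
by split; apply: filterS => x //=; exact.
Qed.

(** * Monotonicity, homogeneity and definiteness of the nested integral; exhaustion by sets of
    finite norm *)

Lemma measurable_ltr_set d (T : measurableType d) (f g : T -> R) :
  measurable_fun setT f -> measurable_fun setT g ->
  measurable [set x | f x < g x].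
Proof.
move=> mf mg; rewrite -[X in measurable X]setTI.
by apply: (measurable_lte measurableT (f := EFin \o f) (g := EFin \o g));
  apply/measurable_EFinP.
Qed.

(** Almost every section of the exceptional set is null, so the induction hypothesis compares the
    inner integrals almost everywhere. Naming the exceptional set explicitly keeps it measurable,
    with sections of the same form. *)
Lemma le_mixed_integral n q (X : 'I_n.+1 -> sfMeasureSpace R)
    (p : 'I_n.+1 -> R) (h1 h2 : prod_space X -> R) :
  (forall i, 0 < p i) -> 0 < q ->
  measurable_fun setT h1 -> measurable_fun setT h2 ->
  sf_measure (prod_space X) [set x | `|h2 x| < `|h1 x|] = 0%E ->
  (mixed_integral q p setT h1 <= mixed_integral q p setT h2)%E.
Proof.
elim: n q X p h1 h2 => [|n IH] q X p h1 h2 p_gt0 q_gt0 mh1 mh2.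
  move=> h0; rewrite !mixed_integral0.
  apply: gt0_ler_poweR; first by rewrite ltW// divr_gt0.
  - by rewrite in_itv/= leey integral_ge0// => x _; rewrite lee_fin powR_ge0.
  - by rewrite in_itv/= leey integral_ge0// => x _; rewrite lee_fin powR_ge0.
  refine (ae_ge0_le_integral measurableT _ _ _ _ _).
  - by move=> x _; rewrite lee_fin powR_ge0.
  - exact: measurable_norm_powR.
  - by move=> x _; rewrite lee_fin powR_ge0.
  - exact: measurable_norm_powR.
  exists [set x | `|h2 x| < `|h1 x|]; split => //.
    by apply: measurable_ltr_set; exact: measurableT_comp.
  move=> x /= nle; rewrite ltNge; apply/negP => h12; apply: nle => _.
  by rewrite lee_fin ge0_ler_powR// ?nnegrE// ltW.
set A := [set _ | _] => A0.
have mA : measurable A by apply: measurable_ltr_set; exact: measurableT_comp.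
move/(prod_measure_eq0 mA) : A0 => A0.
rewrite !mixed_integralS; apply: gt0_ler_poweR.
- by rewrite ltW// divr_gt0.
- rewrite in_itv/= leey integral_ge0// => x _; exact: mixed_integral_ge0.
- rewrite in_itv/= leey integral_ge0// => x _; exact: mixed_integral_ge0.
refine (ae_ge0_le_integral measurableT _ _ _ _ _).
- by move=> x _; exact: mixed_integral_ge0.
- exact: measurable_mixed_integral.
- by move=> x _; exact: mixed_integral_ge0.
- exact: measurable_mixed_integral.
apply: filterS A0 => x Ax0 _; apply: IH => //.
- exact: measurable_fun_pair2.
- exact: measurable_fun_pair2.
rewrite -[RHS]Ax0; congr (sf_measure _ _).
by apply/seteqP; split=> y; rewrite /xsection /= inE.
Qed.

Lemma mixed_integralZ n q (X : 'I_n.+1 -> sfMeasureSpace R)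
    (p : 'I_n.+1 -> R) (c : R) (h : prod_space X -> R) :
  (forall i, 0 < p i) -> 0 < q -> measurable_fun setT h ->
  mixed_integral q p setT (fun x => c * h x) =
  ((`|c| `^ q)%:E * mixed_integral q p setT h)%E.
Proof.
elim: n q X p h => [|n IH] q X p h p_gt0 q_gt0 mh.
  rewrite !mixed_integral0.
  under eq_integral do rewrite normrM powRM// EFinM.
  rewrite ge0_integralZl_EFin ?powR_ge0//; last first.
    exact: measurable_norm_powR.
  rewrite poweRM ?lee_fin ?powR_ge0//; last first.
    by apply: integral_ge0 => x _; rewrite lee_fin powR_ge0.
  (* The factor [|c|] to the power [p ord0] comes out of the integral, and the outer exponent
     [q / p ord0] turns it into [|c|] to the power [q]. *)
  by rewrite poweR_EFin -powRrM mulrCA divff ?mulr1// gt_eqF.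
rewrite !mixed_integralS.
under eq_integral.
  move=> x _; rewrite IH//; last exact: measurable_fun_pair2.
  over.
rewrite ge0_integralZl_EFin ?powR_ge0//; last first.
- exact: measurable_mixed_integral.
- by move=> x _; exact: mixed_integral_ge0.
rewrite poweRM ?lee_fin ?powR_ge0//; last first.
  by apply: integral_ge0 => x _; exact: mixed_integral_ge0.
by rewrite poweR_EFin -powRrM mulrCA divff ?mulr1// gt_eqF.
Qed.

(** If the outer integral is zero, the inner one vanishes for almost every first coordinate; by
    induction almost every section of the set is null, hence so is the set. *)
Lemma mixed_integral_eq0 n q (X : 'I_n.+1 -> sfMeasureSpace R)
    (p : 'I_n.+1 -> R) (h : prod_space X -> R) :
  (forall i, 0 < p i) -> measurable_fun setT h ->
  mixed_integral q p setT h = 0%E ->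
  sf_measure (prod_space X) [set x | 0 < `|h x|] = 0%E.
Proof.
elim: n q X p h => [|n IH] q X p h p_gt0 mh.
  rewrite mixed_integral0 => /poweR_eq0_eq0 h0.
  have mhp := measurable_norm_powR (p ord0) mh.
  have /(ae_eq_integral_abs _ measurableT mhp) hp0 :
      (\int[sf_measure (X ord0)]_x `|(`|h x| `^ p ord0)%:E|)%E = 0%E.
    rewrite -[RHS]h0; last by apply: integral_ge0 => x _; rewrite lee_fin powR_ge0.
    by apply: eq_integral => x _; rewrite gee0_abs// lee_fin powR_ge0.
  apply/negligibleP.
    by apply: measurable_ltr_set => //; exact: measurableT_comp.
  apply: negligibleS hp0 => x /= hx /(_ I) /= [] /powR_eq0_eq0 hx0.
  by rewrite hx0 ltxx in hx.
rewrite mixed_integralS => /poweR_eq0_eq0 h0.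
have mhx := measurable_mixed_integral (p ord0) (fun i => p (lift ord0 i)) mh.
have /(ae_eq_integral_abs _ measurableT mhx) hp0 :
    (\int[sf_measure (X ord0)]_x
       `|mixed_integral (p ord0) (fun i => p (lift ord0 i)) setT
          (fun y : prod_space (fun i => X (lift ord0 i)) => h (x, y))|)%E = 0%E.
  rewrite -[RHS]h0; last by apply: integral_ge0 => x _; exact: mixed_integral_ge0.
  by apply: eq_integral => x _; rewrite gee0_abs// mixed_integral_ge0.
set A := [set _ | _].
have mA : measurable A.
  by apply: measurable_ltr_set => //; exact: measurableT_comp.
apply/(prod_measure_eq0 mA); apply: filterS hp0 => x /(_ I) hx0.
have mhx2 : measurable_fun setT (fun y => h (x, y)) by exact: measurable_fun_pair2.
rewrite -[RHS](IH _ _ _ _ (fun i => p_gt0 _) mhx2 hx0); congr (sf_measure _ _).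
by apply/seteqP; split=> y; rewrite /xsection /= inE.
Qed.

(** The sets are products of a sigma-finite exhaustion of the first factor with the sets obtained
    inductively for the other factors, at the exponent [p ord0] that the inner integral carries. *)
Lemma mixed_integral_cover n q (X : 'I_n.+1 -> sfMeasureSpace R)
    (p : 'I_n.+1 -> R) :
  (forall i, 0 < p i) -> 0 < q ->
  exists F : nat -> set (prod_space X),
    [/\ setT = \bigcup_k F k, nondecreasing_seq F, forall k, measurable (F k) &
        forall k, (mixed_integral q p setT \1_(F k) < +oo)%E].
Proof.
elim: n q X p => [|n IH] q X p p_gt0 q_gt0.
  have /sigma_finiteP[F [TF ndF Foo]] := sigma_finiteT (sf_measure (X ord0)).
  exists F; split => // k; have [mF Fk] := Foo k; first exact: mF.
  by rewrite mixed_integral0; apply: poweR_lty; rewrite integral_norm_powR_indic.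
have /sigma_finiteP[F [TF ndF Foo]] := sigma_finiteT (sf_measure (X ord0)).
have [G [TG ndG mG Goo]] := IH (p ord0) (fun i => X (lift ord0 i)) _
  (fun i => p_gt0 (lift ord0 i)) (p_gt0 ord0).
exists (fun k => F k `*` G k); split.
- rewrite -setXTT TF TG predeqE => -[x y]; split.
  + move=> [/= [i _ Fix] [k _ Gky]]; exists (maxn i k) => //; split.
      by move: x Fix; exact/subsetPset/ndF/leq_maxl.
    by move: y Gky; exact/subsetPset/ndG/leq_maxr.
  + by move=> [i _ []/= ? ?]; split; exists i.
- move=> i k ik; apply/subsetPset => -[x y] [/= Fx Gy]; split.
    by move: x Fx; exact/subsetPset/ndF.
  by move: y Gy; exact/subsetPset/ndG.
- by move=> k; apply: measurableX; [exact: (Foo k).1|exact: mG].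
move=> k; have [mF Fk] := Foo k.
rewrite mixed_integralS; apply: poweR_lty.
(* The indicator of a rectangle separates the variables. By homogeneity the integral is the measure
   of [F k] times the nested integral of [\1_(G k)], both finite. *)
have -> : \1_(F k `*` G k) = fun z => \1_(F k) z.1 * \1_(G k) z.2 :> R.
  by apply/funext => -[x y]; rewrite !indicE in_setX -natrM mulnb.
under eq_integral.
  move=> x _; rewrite /= mixed_integralZ//; over.
rewrite ge0_integralZr//; last exact: mixed_integral_ge0.
  rewrite integral_norm_powR_indic//.
  by apply: lte_mul_pinfty => //; rewrite ge0_fin_numE.
apply: measurable_norm_powR; exact: measurable_indic.
Qed.

(** On a product of measure zero the essential supremum would be [-oo], whereas an operator norm is
    never negative; positivity excludes this case. *)
Lemma prod_space_gt0 n (X : 'I_n.+1 -> sfMeasureSpace R) :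
  (forall i, 0 < sf_measure (X i) setT)%E ->
  (0 < sf_measure (prod_space X) setT)%E.
Proof.
elim: n X => [|n IH] X X_gt0; first exact: X_gt0.
rewrite -setXTT /= /prod_measure product_measure1E//.
apply: mule_gt0; first exact: X_gt0.
exact: (IH (fun i => X (lift ord0 i)) (fun i => X_gt0 _)).
Qed.

End mixed_integral_theory.

(** * Mixed norms over [Omega] and the multiplication operator *)

Section multiplication_operator.
Variables (R : realType) (n : nat) (X : 'I_n.+1 -> sfMeasureSpace R).
Variables (p : 'I_n.+1 -> R) (Omega : set (prod_space X)).
Hypotheses (p_gt0 : forall i, 0 < p i) (mOmega : measurable Omega).
Implicit Types f g : prod_space X -> R.
Local Notation mu := (sf_measure (prod_space X)).
Local Notation "f \|Omega" := (fun x => f x * \1_Omega x) (at level 2).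

Lemma measurable_fun_mul_indic f :
  measurable_fun Omega f -> measurable_fun setT f\|Omega.
Proof.
move=> /(measurable_restrictT f mOmega) mf.
apply: eq_measurable_fun (measurable_funM mf (measurable_indic mOmega)).
by move=> x _ /=; rewrite /patch indicE; case: ifP; rewrite ?mulr1 ?mulr0.
Qed.

Lemma mixed_norm_ge0 f : (0 <= mixed_norm p Omega f)%E.
Proof. exact: mixed_integral_ge0. Qed.

Lemma mixed_normE f :
  mixed_norm p Omega f = mixed_integral 1 p setT f\|Omega.
Proof. exact: mixed_integral_restrict. Qed.

Lemma mixed_normZ c f : measurable_fun Omega f ->
  mixed_norm p Omega (fun x => c * f x) = (`|c|%:E * mixed_norm p Omega f)%E.
Proof.
move=> mf; rewrite !mixed_normE; under eq_fun do rewrite -mulrA.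
by rewrite mixed_integralZ ?powRr1//; exact: measurable_fun_mul_indic.
Qed.

Lemma le_mixed_norm_mul f g c : measurable_fun Omega f ->
  measurable_fun Omega g -> 0 <= c -> (ess_sup_abs Omega g <= c%:E)%E ->
  (mixed_norm p Omega (mul_operator g f) <= c%:E * mixed_norm p Omega f)%E.
Proof.
move=> mf mg c_ge0 /ess_supP gc.
rewrite -[c in X in (_ <= X)%E]ger0_norm// -mixed_normZ// !mixed_normE.
have m1 : measurable_fun setT (mul_operator g f)\|Omega.
  by apply: measurable_fun_mul_indic; exact: measurable_funM.
have m2 : measurable_fun setT (fun x => c * f x)\|Omega.
  by apply: measurable_fun_mul_indic; exact: measurable_funM.
apply: le_mixed_integral => //; apply/negligibleP.
  by apply: measurable_ltr_set; exact: measurableT_comp.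
(* Where the comparison fails, [x] lies in [Omega] and [|g x|] exceeds [c]: outside [Omega] both
   sides are zero. *)
apply: negligibleS gc => x /= lt_cg; rewrite lee_fin => le_gc.
move: lt_cg le_gc; rewrite /mul_operator !normrM (ger0_norm c_ge0) indicE.
case: (x \in Omega); rewrite ?(normr1, normr0) ?(mulr1, mulr0) ?ltxx//.
by rewrite mulrC ltNge => /negP nle gc; apply: nle; rewrite ler_wpM2l.
Qed.

(** The constant [c] is arbitrary because the bound serves twice: with an operator bound it shows
    that [g] is essentially bounded, and with the operator norm itself it gives the lower estimate
    of that norm. *)
Lemma ess_sup_abs_le g c : measurable_fun Omega g -> 0 <= c ->
  (forall f, L_mixed p Omega f ->
    (mixed_norm p Omega (mul_operator g f) <= c%:E * mixed_norm p Omega f)%E) ->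
  (ess_sup_abs Omega g <= c%:E)%E.
Proof.
move=> mg c_ge0 gc; apply/lee_addgt0Pr => e e_gt0; rewrite -EFinD.
have [F [TF _ mF Foo]] := mixed_integral_cover X p_gt0 ltr01.
have mg1 := measurable_fun_mul_indic mg.
pose E := [set x | c + e < `|g\|Omega x|].
have mE : measurable E by apply: measurable_ltr_set => //; exact: measurableT_comp.
(* Since [c + e] is nonnegative and the cut-off [g] vanishes off [Omega], no point outside [Omega]
   can be in [E]. *)
have EOmega x : E x -> Omega x.
  rewrite /E /= indicE; case: (boolP (x \in Omega)) => [/set_mem//|_].
  by rewrite mulr0 normr0 ltNge addr_ge0// ltW.
have EF0 k : mu (E `&` F k) = 0%E.
  have mEF : measurable (E `&` F k) by exact: measurableI.
  pose f : prod_space X -> R := \1_(E `&` F k).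
  have mf : measurable_fun setT f by exact: measurable_indic.
  have fOmega : f\|Omega = f.
    apply/funext => x; rewrite /f indicE; case: (boolP (x \in E `&` F k)).
      by move=> /set_mem[/EOmega xO _]; rewrite indicE mem_set// mulr1.
    by rewrite mul0r.
  have fE : mixed_norm p Omega f = mixed_integral 1 p setT f.
    by rewrite mixed_normE fOmega.
  have foo : (mixed_norm p Omega f < +oo)%E.
    apply: le_lt_trans (Foo k); rewrite fE; apply: le_mixed_integral => //.
    rewrite (_ : [set _ | _] = set0) ?measure0// -subset0 => x /=.
    rewrite /f !indicE in_setI; case: (x \in F k); last by rewrite andbF ltxx.
    rewrite andbT normr1; case: (x \in E); first by rewrite normr1 ltxx.
    by rewrite normr0 ltNge ler01.
  have Lf : L_mixed p Omega f by split => //; exact: measurable_funTS.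
  (* By definiteness, zero norm makes the set where [f] is nonzero null, and that set is [E]
     intersected with [F k]. *)
  suff f0 : mixed_norm p Omega f = 0%E.
    have <- := mixed_integral_eq0 p_gt0 mf (etrans (esym fE) f0).
    congr (mu _); apply/seteqP; split => x /=; rewrite /f indicE.
      by move=> EFx; rewrite mem_set// normr1.
    by case: (boolP (x \in _)) => [/set_mem//|_]; rewrite normr0 ltxx.
  have := gc _ Lf.
  have le_ce : ((c + e)%:E * mixed_norm p Omega f <=
                mixed_norm p Omega (mul_operator g f))%E.
    have ce_ge0 : 0 <= c + e by rewrite addr_ge0// ltW.
    rewrite -[in X in (X * _)%E](ger0_norm ce_ge0) -mixed_normZ; last exact: Lf.1.
    rewrite 2!mixed_normE; apply: le_mixed_integral => //.
    - apply: measurable_fun_mul_indic; apply: measurable_funM => //; exact: Lf.1.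
    - apply: measurable_fun_mul_indic; apply: measurable_funM => //; exact: Lf.1.
    rewrite (_ : [set _ | _] = set0) ?measure0// -subset0 => x /=.
    rewrite /mul_operator /f (indicE _ (E `&` F k)).
    case: (boolP (x \in E `&` F k)) => [/set_mem[Ex _]|_].
      have := Ex; rewrite /E /= indicE (mem_set (EOmega _ Ex)) !mulr1 mul1r.
      by rewrite (ger0_norm ce_ge0) => /lt_trans /[apply]; rewrite ltxx.
    by rewrite mulr0 !mul0r ltxx.
  move=> /(le_trans le_ce).
  have /fineK <- : mixed_norm p Omega f \is a fin_num.
    by rewrite ge0_fin_numE// mixed_norm_ge0.
  (* The norm is finite, so [c] times it can be cancelled; what remains is [e] times the norm being
     at most zero. *)
  rewrite -!EFinM lee_fin mulrDl gerDl pmulr_rle0// => le0.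
  congr EFin; apply/eqP; rewrite eq_le le0/= fine_ge0//; exact: mixed_norm_ge0.
apply/ess_supP; exists E; split => //.
  rewrite -(setIT E) TF setI_bigcupr; apply/negligibleP.
    by apply: bigcupT_measurable => k; exact: measurableI.
  apply: negligible_bigcup => k; apply/negligibleP; last exact: EF0.
  exact: measurableI.
move=> x /=; rewrite lee_fin => /negP; rewrite -ltNge /E /= normrM.
by rewrite (ger0_norm (_ : 0 <= \1_Omega x)).
Qed.

Lemma bounded_mul_operatorP g : measurable_fun Omega g ->
  bounded_operator p Omega (mul_operator g) <-> L_infty Omega g.
Proof.
move=> mg; split=> [[K bK]|[_ goo]].
  (* A bound [K] may be negative when all norms vanish, hence the maximum with 0. *)
  split=> //; apply: (@le_lt_trans _ _ (Num.max K 0)%:E); last exact: ltry.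
  apply: ess_sup_abs_le => // [|f Lf]; first by rewrite le_max lexx orbT.
  have [_ /le_trans] := bK f Lf; apply.
  by rewrite lee_wpmul2r ?mixed_norm_ge0// lee_fin le_max lexx.
have [K K_ge0 gK] : exists2 K, 0 <= K & (ess_sup_abs Omega g <= K%:E)%E.
  (* The value [-oo] is possible here, as the product may have measure zero; then 0 serves as the
     bound. *)
  move: goo; case: (ess_sup_abs Omega g) => [r _|//|_]; last first.
    by exists 0; rewrite ?leNye.
  by exists (Num.max r 0); rewrite ?lee_fin le_max lexx ?orbT.
exists K => f [mf foo]; have le_fg := le_mixed_norm_mul mf mg K_ge0 gK.
split=> //; split; first exact: measurable_funM.
by apply: le_lt_trans le_fg _; rewrite lte_mul_pinfty.
Qed.

(** The upper estimate is the pointwise bound on the unit ball. For the lower one, normalization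
    extends the unit-ball estimate to all of [L_mixed], and [ess_sup_abs_le] applies with the
    operator norm as constant. *)
Lemma operator_norm_mul g : measurable_fun Omega g ->
  (0 < mu setT)%E -> L_infty Omega g ->
  operator_norm p Omega (mul_operator g) = ess_sup_abs Omega g.
Proof.
move=> mg mu_gt0 [_ goo].
have g_ge0 : (0 <= ess_sup_abs Omega g)%E.
  apply: ess_sup_gee => //; apply: aeW => x.
  by rewrite lee_fin mulr_ge0.
have gfin : ess_sup_abs Omega g \is a fin_num by rewrite ge0_fin_numE.
have m_ge0 := fine_ge0 g_ge0.
have le_mul f : measurable_fun Omega f ->
    (mixed_norm p Omega (mul_operator g f) <=
     ess_sup_abs Omega g * mixed_norm p Omega f)%E.
  by move=> mf; rewrite -(fineK gfin); apply: le_mixed_norm_mul; rewrite ?fineK.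
set N := operator_norm _ _ _.
have Nub f : L_mixed p Omega f -> (mixed_norm p Omega f <= 1)%E ->
    (mixed_norm p Omega (mul_operator g f) <= N)%E.
  by move=> Lf f1; apply: ereal_sup_ubound; exists f.
have Nle : (N <= ess_sup_abs Omega g)%E.
  apply: ge_ereal_sup => _ [f [[mf _] f1] <-].
  by apply: le_trans (le_mul f mf) _; rewrite -[leRHS]mule1 lee_wpmul2l.
(* The zero function lies in the unit ball. Together with the upper estimate this makes [N] a
   nonnegative real, as [ess_sup_abs_le] requires. *)
have N_ge0 : (0 <= N)%E.
  have n0 : mixed_norm p Omega (fun=> 0) = 0%E.
    rewrite -[LHS](_ : mixed_norm p Omega (fun x => 0 * cst 0 x) = _).
      by rewrite mixed_normZ ?normr0 ?mul0e.
    by congr mixed_norm; apply/funext => x; rewrite mul0r.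
  apply: le_trans (Nub (fun=> 0) _ _); first exact: mixed_norm_ge0.
    by split; rewrite ?n0//; exact: measurable_cst.
  by rewrite n0 lee01.
have Nfin : N \is a fin_num by rewrite ge0_fin_numE// (le_lt_trans Nle).
apply/eqP; rewrite eq_le Nle/= -(fineK Nfin).
apply: ess_sup_abs_le => //; first exact: fine_ge0.
move=> f [mf foo].
have ffin : mixed_norm p Omega f \is a fin_num.
  by rewrite ge0_fin_numE// mixed_norm_ge0.
(* A function of norm zero cannot be normalized, but the upper estimate already sends it to norm
   zero. *)
have [f0|f_neq0] := eqVneq (mixed_norm p Omega f) 0%E.
  by apply: le_trans (le_mul f mf) _; rewrite f0 !mule0.
have r_gt0 : 0 < fine (mixed_norm p Omega f).
  by rewrite fine_gt0// ltey_eq ffin andbT lt0e f_neq0 mixed_norm_ge0.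
set r := fine _ in r_gt0.
have rf : mixed_norm p Omega (fun x => r^-1 * f x) = 1%E.
  rewrite mixed_normZ// gtr0_norm ?invr_gt0// -(fineK ffin) -EFinM mulVf//.
  by rewrite gt_eqF.
have := Nub (fun x => r^-1 * f x).
rewrite rf lexx; move=> /(_ _ isT)/wrap[].
  by split; [exact: measurable_funM|rewrite rf ltry].
rewrite (_ : mul_operator _ _ = fun x => r^-1 * mul_operator g f x); last first.
  by apply/funext => x; rewrite /mul_operator mulrA.
rewrite mixed_normZ; last exact: measurable_funM.
by rewrite gtr0_norm ?invr_gt0// lee_pdivrMl// /r !fineK// muleC.
Qed.

End multiplication_operator.

Theorem theorem5p1 (R : realType) (n : nat)
    (X : 'I_n.+1 -> homogeneousSpace R)
    (Omega : set (prod_space (fun i => sf_of_hs (X i)))) (mOmega : measurable Omega)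
    (p : 'I_n.+1 -> R) (p_ge1 : forall i, 1 <= p i)
    (g : prod_space (fun i => sf_of_hs (X i)) -> R) (mg : measurable_fun Omega g) :
  (bounded_operator p Omega (mul_operator g) <-> L_infty Omega g) /\
  (bounded_operator p Omega (mul_operator g) ->
   operator_norm p Omega (mul_operator g) = ess_sup_abs Omega g).
Proof.
have p_gt0 i : 0 < p i by exact: lt_le_trans ltr01 (p_ge1 i).
have bg := bounded_mul_operatorP p_gt0 mOmega mg.
split; first exact: bg.
move=> /bg Lg; apply: operator_norm_mul => //.
(* Each factor has positive measure because doubling, taken at one point with radius 1, provides a
   ball of positive measure. *)
apply: prod_space_gt0 => i /=.
have [c /(_ point 1 ltr01)[ball_gt0 _ _]] := hs_doubling (X i).
apply: lt_le_trans ball_gt0 _; apply: le_measure; rewrite ?inE//.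
exact: measurable_metric_ball.
Qed.
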